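(* For each $\mu,\nu\in(0,1)$, $\vartheta_L=\vartheta_Q=1$ and each $\varepsilon\in(0,\frac23)$, there exists a univariate function $f_{\mu,\nu,\varepsilon}:\mathbb{R}\to\mathbb{R}$ which is twice continuously differentiable, has Lipschitz continuous gradient and Hessian, and is bounded below, such that, when applied to minimize $f_{\mu,\nu,\varepsilon}$ from the origin, the ASTR2 algorithm (described in the context) with scaling factors satisfying, for all $k\ge0$, $$w_k^L\in[\vartheta_L\hat w_k^L,\hat w_k^L],\quad \hat w_k^L=\Big(\varsigma+\sum_{\ell=0,\ \ell\in\mathcal{K}^L}^k\|g_\ell\|^2\Big)^{\mu},\qquad w_k^Q\in[\vartheta_Q\hat w_k^Q,\hat w_k^Q],\quad \hat w_k^Q=\Big(\varsigma+\sum_{\ell=0,\ \ell\in\mathcal{K}^Q}^k\hat\phi_\ell^3\Big)^{\nu}$$ (where $\varsigma>0$; since $\vartheta_L=\vartheta_Q=1$, $w_k^L=\hat w_k^L$ and $w_k^Q=\hat w_k^Q$) produces second-order optimality measures given by $$\phi_k=\hat\phi_k=\min_{j\in\{0,\dots,k\}}\hat\phi_j=\frac{1}{(k+1)^{\frac13+\varepsilon}}.$$ In this sense, the bound $\min_{j\in\{0,\dots,k\}}\hat\phi_j\le\kappa/(k+1)^{1/3}$ (with $\kappa$ a constant independent of $k$) for this algorithm is essentially sharp.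
   Context: $\|\cdot\|$ is the Euclidean norm; $g(x)=\nabla f(x)$, $H(x)=\nabla^2 f(x)$; $\lambda_{\min}[\cdot]$ is the smallest eigenvalue. A bound is called essentially sharp when a lower bound on evaluation complexity exists which is arbitrarily close to the upper bound. ASTR2 algorithm (for minimizing $f:\mathbb{R}^n\to\mathbb{R}$). Parameters: $\tau,\chi\in(0,1]$, $\xi\ge1$, starting point $x_0\in\mathbb{R}^n$. For $k=0,1,2,\dots$ (no termination test): 1. Set $g_k=g(x_k)$, $H_k=H(x_k)$, $\phi_k=\max_{\|d\|\le1}-\big(g_k^Td+\frac12 d^TH_kd\big)$ and $\hat\phi_k=\min[\phi_k,\xi]$. 2. Given scaling factors $w_k^L,w_k^Q$ (depending on $x_0,\dots,x_k$), set $\Delta_k^L=\|g_k\|/w_k^L$ and $\Delta_k^Q=\hat\phi_k/w_k^Q$. 3. If $\|g_k\|^2\ge\hat\phi_k^3$, set $s_k=s_k^L=-g_k/w_k^L$. Otherwise set $s_k=s_k^Q$, where $s_k^Q$ is such that $\|s_k^Q\|\le\Delta_k^Q$ and $\Delta q_k\ge\tau\max[\Delta q_k^C,\Delta q_k^E]$. Here, with $m_k(s)=-(g_k^Ts+\frac12 s^TH_ks)$, $\Delta q_k=m_k(s_k^Q)$, $\Delta q_k^C=\max\{m_k(-\alpha g_k):\alpha\ge0,\ \alpha\|g_k\|\le\Delta_k^Q\}$ and $\Delta q_k^E=\max\{m_k(\alpha u_k):0\le\alpha\le\Delta_k^Q\}$, where $u_k$ satisfies $u_k^TH_ku_k\le\chi\lambda_{\min}[H_k]$,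 $u_k^Tg_k\le0$ and $\|u_k\|=1$. 4. Set $x_{k+1}=x_k+s_k$. $\mathcal{K}^L=\{k\ge0: s_k=s_k^L\}$ is the set of iterations where the first option of Step 3 is taken, and $\mathcal{K}^Q=\{k\ge0:s_k=s_k^Q\}$ is the set of iterations where the second is taken. *)

(* Defs.v *)
From Stdlib Require Import Reals Lra.
From Coquelicot Require Import Coquelicot.
Open Scope R_scope.

(* Everything is univariate: the Euclidean norm is [Rabs], g and H are the
   first two derivatives, and the smallest eigenvalue of the 1x1 Hessian is
   its only entry. *)
Definition grad (f : R -> R) : R -> R := Derive f.
Definition hess (f : R -> R) : R -> R := Derive_n f 2.

Definition is_max (E : R -> Prop) (m : R) : Prop :=
  E m /\ forall y, E y -> y <= m.

Definition is_min (E : R -> Prop) (m : R) : Prop :=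
  E m /\ forall y, E y -> m <= y.

Definition lipschitz (h : R -> R) : Prop :=
  exists L : R, forall x y, Rabs (h x - h y) <= L * Rabs (x - y).

Definition bounded_below (f : R -> R) : Prop :=
  exists m : R, forall x, m <= f x.

Definition C2 (f : R -> R) : Prop :=
  (forall x, ex_derive_n f 1 x) /\ (forall x, ex_derive_n f 2 x) /\
  (forall x, continuous (hess f) x).

(* Decrease in the quadratic model, m_k(s), for gradient [g] and Hessian [h]. *)
Definition model_dec (g h s : R) : R := - (g * s + / 2 * (s * h * s)).

Definition is_phi (g h v : R) : Prop :=
  is_max (fun y => exists d, Rabs d <= 1 /\ y = model_dec g h d) v.

Definition is_cauchy_dec (g h Delta v : R) : Prop :=
  is_max (fun y => exists alpha,
    0 <= alpha /\ alpha * Rabs g <= Delta /\ y = model_dec g h (- alpha * g)) v.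

Definition is_eigen_dec (g h u Delta v : R) : Prop :=
  is_max (fun y => exists alpha,
    0 <= alpha <= Delta /\ y = model_dec g h (alpha * u)) v.

Definition quadratic_step (tau chi g h Delta s : R) : Prop :=
  Rabs s <= Delta /\
  exists u qC qE : R,
    u * h * u <= chi * h /\ u * g <= 0 /\ Rabs u = 1 /\
    is_cauchy_dec g h Delta qC /\ is_eigen_dec g h u Delta qE /\
    tau * Rmax qC qE <= model_dec g h s.

(* Membership of an iteration in K^L; its negation is membership in K^Q. *)
Definition in_KL (g phih : nat -> R) (k : nat) : Prop :=
  phih k ^ 3 <= Rabs (g k) ^ 2.

Definition in_KL_dec (g phih : nat -> R) (k : nat) :
  {in_KL g phih k} + {~ in_KL g phih k} := Rle_dec _ _.

(* A possible execution of ASTR2 on [f] from [x0]: iterates [x], steps [s],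
   measures [phi] and [phih] (the latter being phi hat), scaling factors [wL]
   and [wQ].  It is a relation because the algorithm does not determine the
   quadratic step (nor u_k) uniquely. *)
Record ASTR2_run (tau chi xi : R) (f : R -> R) (x0 : R)
    (x s phi phih wL wQ : nat -> R) : Prop := {
  run_init : x 0%nat = x0;
  run_phi : forall k, is_phi (grad f (x k)) (hess f (x k)) (phi k);
  run_phih : forall k, phih k = Rmin (phi k) xi;
  run_linear : forall k, in_KL (fun l => grad f (x l)) phih k ->
    s k = - grad f (x k) / wL k;
  run_quadratic : forall k, ~ in_KL (fun l => grad f (x l)) phih k ->
    quadratic_step tau chi (grad f (x k)) (hess f (x k)) (phih k / wQ k) (s k);
  run_next : forall k, x (S k) = x k + s k
}.

Definition hat_wL (sigma mu : R) (g phih : nat -> R) (k : nat) : R :=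
  Rpower (sigma + sum_f_R0
    (fun l => if in_KL_dec g phih l then Rabs (g l) ^ 2 else 0) k) mu.

Definition hat_wQ (sigma nu : R) (g phih : nat -> R) (k : nat) : R :=
  Rpower (sigma + sum_f_R0
    (fun l => if in_KL_dec g phih l then 0 else phih l ^ 3) k) nu.

Definition scaling_rule (thetaL thetaQ sigma mu nu : R)
    (g phih wL wQ : nat -> R) : Prop :=
  forall k : nat,
    thetaL * hat_wL sigma mu g phih k <= wL k <= hat_wL sigma mu g phih k /\
    thetaQ * hat_wQ sigma nu g phih k <= wQ k <= hat_wQ sigma nu g phih k.

(* Main.v *)
Require Import Defs.
From Stdlib Require Import Reals Lra Lia.
From Coquelicot Require Import Coquelicot.
Open Scope R_scope.

(* Prescribe zero gradients and Hessians -2 u_k, with u_k = (k+1)^(-1/3-eps), at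
   the iterates.  Then phi_k = u_k, every iteration takes the quadratic step, and
   the full step s_k = u_k / w_k is allowed.  Since the sum of u_k^3 converges, w_k
   stays between two positive constants, so s_k is of order u_k and the iterates
   go to infinity (as 1/3 + eps < 1).  Between two iterates the Hessian is a
   quadratic with zero mean; because u_k / s_k is bounded it is uniformly
   Lipschitz, and because f drops by at most 2 u_k s_k^2, of order u_k^3, on each
   interval, f is bounded below.  The Hessian is extended to the negative
   half-line as an even function. *)

(** * Lipschitz functions and consequences of the mean value theorem *)

Lemma lipschitz_ext (h k : R -> R) :
  (forall x, h x = k x) -> lipschitz k -> lipschitz h.
Proof.
intros E [L HL]; exists L; intros x y; rewrite !E; apply HL.
Qed.

Lemma continuous_of_lipschitz (h : R -> R) :
  lipschitz h -> forall x, continuous h x.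
Proof.
intros [L HL] x.
apply continuity_pt_filterlim.
intros e He; exists (e / (Rabs L + 1)); split.
- apply Rdiv_lt_0_compat; [exact He | pose proof (Rabs_pos L); lra].
- intros y [_ Hy]; simpl in *; unfold Rdist in *.
  pose proof (Rabs_pos L); pose proof (Rabs_pos (y - x)).
  apply Rle_lt_trans with ((Rabs L + 1) * Rabs (y - x)).
  + apply Rle_trans with (1 := HL y x).
    pose proof (Rle_abs L); nra.
  + apply (Rmult_lt_compat_l (Rabs L + 1)) in Hy; [|lra].
    replace ((Rabs L + 1) * (e / (Rabs L + 1))) with e in Hy by (field; lra).
    exact Hy.
Qed.

Lemma lipschitz_of_bounded_derive (F dF : R -> R) (C : R) :
  (forall x, is_derive F x (dF x)) -> (forall x, Rabs (dF x) <= C) ->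
  lipschitz F.
Proof.
intros HF HC; exists C; intros x y.
destruct (MVT_gen F y x dF) as [c [_ Hc]].
- intros z _; apply HF.
- intros z _; apply continuity_pt_filterlim.
  apply (ex_derive_continuous F); exists (dF z); apply HF.
- rewrite Hc, Rabs_mult.
  apply Rmult_le_compat_r; [apply Rabs_pos | apply HC].
Qed.

(** The mean value theorem applied to [F - K]. It serves to identify functions defined by integrals
    with closed forms and to transfer parity. *)
Lemma eq_of_derive_eq (F K dF dK : R -> R) (a b : R) :
  a <= b ->
  (forall x, is_derive F x (dF x)) -> (forall x, is_derive K x (dK x)) ->
  (forall x, a <= x <= b -> dF x = dK x) -> F a = K a -> F b = K b.
Proof.
intros Hab HF HK Hd Ha.
destruct (MVT_gen (fun x => F x - K x) a b (fun x => dF x - dK x))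
  as [c [Hc1 Hc2]].
- intros z _; apply (is_derive_minus F K z (dF z) (dK z)); auto.
- intros z _; apply continuity_pt_filterlim.
  apply (ex_derive_continuous (fun x => F x - K x)).
  exists (dF z - dK z).
  apply (is_derive_minus F K z (dF z) (dK z)); auto.
- rewrite Rmin_left, Rmax_right in Hc1 by exact Hab.
  rewrite (Hd c Hc1) in Hc2; lra.
Qed.

(** For points on opposite sides of [c], the distances to [c] add up to [Rabs (x - y)], so the
    constant does not grow with the number of pieces glued. *)
Lemma lipschitz_glue (L c : R) (h k : R -> R) :
  (forall x y, Rabs (h x - h y) <= L * Rabs (x - y)) ->
  (forall x y, Rabs (k x - k y) <= L * Rabs (x - y)) ->
  h c = k c ->
  forall x y, Rabs ((if Rle_dec x c then h x else k x)
                    - (if Rle_dec y c then h y else k y)) <= L * Rabs (x - y).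
Proof.
intros Hh Hk Hc.
assert (cross : forall x y, x <= c -> c <= y ->
          Rabs (h x - k y) <= L * Rabs (x - y)).
{ intros x y Hx Hy.
  replace (h x - k y) with ((h x - h c) + (k c - k y)) by lra.
  apply Rle_trans with (1 := Rabs_triang _ _).
  pose proof (Hh x c) as H1; pose proof (Hk c y) as H2.
  rewrite (Rabs_left1 (x - y)) by lra.
  rewrite (Rabs_left1 (x - c)) in H1 by lra.
  rewrite (Rabs_left1 (c - y)) in H2 by lra.
  lra. }
intros x y; destruct (Rle_dec x c), (Rle_dec y c); auto.
- apply cross; lra.
- rewrite Rabs_minus_sym, (Rabs_minus_sym x y); apply cross; lra.
Qed.

(** * The rescaled Hessian and gradient on one interval *)

Definition clamp (r : R) : R := Rmax 0 (Rmin 1 r).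

Lemma clamp_bounds (r : R) : 0 <= clamp r <= 1.
Proof.
unfold clamp; split; [apply Rmax_l|].
apply Rmax_lub; [lra | apply Rmin_l].
Qed.

Lemma clamp_id (r : R) : 0 <= r <= 1 -> clamp r = r.
Proof. intros H; unfold clamp; rewrite Rmin_right, Rmax_right; lra. Qed.

Lemma clamp_lipschitz (r t : R) : Rabs (clamp r - clamp t) <= Rabs (r - t).
Proof.
unfold clamp, Rmax, Rmin.
repeat destruct Rle_dec; unfold Rabs; repeat destruct Rcase_abs; lra.
Qed.

(* The second derivative, in the rescaled variable [r] of [0, 1], of the
   quartic whose first derivative [cubic] vanishes at both ends and whose
   second derivative is [-2a] at [0] and [-2b] at [1]. *)
Definition quad (a b r : R) : R :=
  -2 * a + 4 * (b + 2 * a) * r - 6 * (a + b) * r ^ 2.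

Definition cubic (a b r : R) : R :=
  -2 * a * r + 2 * (b + 2 * a) * r ^ 2 - 2 * (a + b) * r ^ 3.

Lemma quad_lipschitz (a b r t : R) :
  0 <= b <= a -> 0 <= r <= 1 -> 0 <= t <= 1 ->
  Rabs (quad a b r - quad a b t) <= 24 * a * Rabs (r - t).
Proof.
intros Hab Hr Ht.
replace (quad a b r - quad a b t)
  with ((4 * (b + 2 * a) - 6 * (a + b) * (r + t)) * (r - t))
  by (unfold quad; ring).
rewrite Rabs_mult; apply Rmult_le_compat_r; [apply Rabs_pos|].
apply Rabs_le; split; nra.
Qed.

Lemma quad_bound (a b r : R) :
  0 <= b <= a -> 0 <= r <= 1 -> Rabs (quad a b r) <= 26 * a.
Proof.
intros Hab Hr.
pose proof (quad_lipschitz a b r 0 Hab Hr ltac:(lra)) as H.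
replace (quad a b r) with (quad a b r - quad a b 0 + -2 * a)
  by (unfold quad; ring).
apply Rle_trans with (1 := Rabs_triang _ _).
rewrite (Rabs_left1 (-2 * a)) by lra.
rewrite Rminus_0_r, (Rabs_pos_eq r) in H by lra.
nra.
Qed.

Lemma cubic_lower_bound (a b r : R) :
  0 <= b <= a -> 0 <= r <= 1 -> -2 * a <= cubic a b r.
Proof.
intros Hab Hr.
(* The factor [r * (1 - r)] shows the zeros at both ends; the remaining linear factor is at least
   its value [-2 * a] at [0]. *)
replace (cubic a b r) with (r * (1 - r) * (-2 * a + 2 * (a + b) * r))
  by (unfold cubic; ring).
assert (0 <= r * (1 - r) <= 1) by nra.
assert (-2 * a <= -2 * a + 2 * (a + b) * r) by nra.
nra.
Qed.

(** * Construction of the objective function from its Hessian *)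

Fixpoint knot (s : nat -> R) (k : nat) : R :=
  match k with
  | O => 0
  | S j => knot s j + s j
  end.

(** Only the first [n] intervals are shaped: the value is constant left of the origin, and the clamp
    keeps it at [-2 * u n] to the right of [knot s n]. *)
Fixpoint hess_upto (u s : nat -> R) (n : nat) (x : R) : R :=
  match n with
  | O => -2 * u 0%nat
  | S k => if Rle_dec x (knot s k) then hess_upto u s k x
           else quad (u k) (u (S k)) (clamp ((x - knot s k) / s k))
  end.

(* The sequence in the limit is eventually constant. *)
Definition spline_hess (u s : nat -> R) (x : R) : R :=
  real (Lim_seq (fun n => hess_upto u s n (Rabs x))).

Definition spline_grad (u s : nat -> R) (x : R) : R :=
  RInt (spline_hess u s) 0 x.

Definition spline (u s : nat -> R) (x : R) : R := RInt (spline_grad u s) 0 x.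

Section Spline.

(** [W] bounds curvature over step length and so controls the Lipschitz constant of the Hessian; [M]
    controls the total descent of the function. *)
Variables (u s : nat -> R) (W M : R).
Hypothesis u_pos : forall k, 0 < u k.
Hypothesis u_decr : forall k, u (S k) <= u k.
Hypothesis s_pos : forall k, 0 < s k.
Hypothesis u_le_s : forall k, u k <= W * s k.
Hypothesis knot_unbounded : forall x, exists n, x <= knot s n.
Hypothesis sum_bound : forall n, sum_f_R0 (fun l => u l * s l ^ 2) n <= M.

Lemma u_le_u0 k : u k <= u 0%nat.
Proof. induction k; [lra | pose proof (u_decr k); lra]. Qed.

Lemma W_pos : 0 < W.
Proof.
pose proof (u_pos 0); pose proof (s_pos 0); pose proof (u_le_s 0); nra.
Qed.

Lemma knot_le n m : (n <= m)%nat -> knot s n <= knot s m.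
Proof.
induction 1; [lra|]. simpl; pose proof (s_pos m); lra.
Qed.

Lemma ratio_bounds k x :
  knot s k <= x <= knot s (S k) -> 0 <= (x - knot s k) / s k <= 1.
Proof.
simpl; intros Hx; pose proof (s_pos k).
split.
- apply Rdiv_le_0_compat; lra.
- apply Rle_div_l; [lra|]; lra.
Qed.

Lemma hess_upto_knot k : hess_upto u s k (knot s k) = -2 * u k.
Proof.
destruct k as [|k]; [reflexivity|].
pose proof (s_pos k); simpl.
destruct Rle_dec; [lra|].
replace ((knot s k + s k - knot s k) / s k) with 1 by (field; lra).
rewrite clamp_id by lra; unfold quad; ring.
Qed.

Lemma hess_upto_piece k x : knot s k <= x <= knot s (S k) ->
  hess_upto u s (S k) x = quad (u k) (u (S k)) ((x - knot s k) / s k).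
Proof.
intros Hx; cbn [hess_upto].
destruct Rle_dec as [H|H].
(* At the left knot the recursion still selects the previous piece, whose value there agrees with
   that of the new one. *)
- replace x with (knot s k) by lra; rewrite hess_upto_knot.
  unfold quad, Rminus, Rdiv; rewrite Rplus_opp_r; ring.
- rewrite clamp_id by now apply ratio_bounds.
  reflexivity.
Qed.

(** Induction by gluing: rescaling turns the constant [24 * u k] of [quad] into [24 * (u k / s k)],
    which is at most [24 * W] whatever [n] is. *)
Lemma hess_upto_lipschitz n x y :
  Rabs (hess_upto u s n x - hess_upto u s n y) <= 24 * W * Rabs (x - y).
Proof.
revert x y; induction n as [|k IH]; intros x y.
- simpl; rewrite Rminus_diag, Rabs_R0.
  pose proof W_pos; pose proof (Rabs_pos (x - y)); nra.
- cbn [hess_upto].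
  (* Gluing asks for pieces that are Lipschitz on the whole line, which the clamp provides. *)
  refine (lipschitz_glue (24 * W) (knot s k) (hess_upto u s k)
    (fun z => quad (u k) (u (S k)) (clamp ((z - knot s k) / s k))) IH _ _ x y).
  + clear x y; intros x y.
    pose proof (u_pos k); pose proof (u_pos (S k)); pose proof (u_decr k).
    pose proof (s_pos k).
    eapply Rle_trans.
    { apply quad_lipschitz; [lra | apply clamp_bounds | apply clamp_bounds]. }
    apply Rle_trans with
      (24 * u k * Rabs ((x - knot s k) / s k - (y - knot s k) / s k)).
    { apply Rmult_le_compat_l; [lra | apply clamp_lipschitz]. }
    replace ((x - knot s k) / s k - (y - knot s k) / s k)
      with ((x - y) * / s k) by (field; lra).
    rewrite Rabs_mult, (Rabs_pos_eq (/ s k))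
      by (left; apply Rinv_0_lt_compat; lra).
    replace (24 * u k * (Rabs (x - y) * / s k))
      with (24 * (u k / s k) * Rabs (x - y)) by (field; lra).
    apply Rmult_le_compat_r; [apply Rabs_pos|].
    apply Rmult_le_compat_l; [lra|].
    apply Rle_div_l; [lra | apply u_le_s].
  + rewrite hess_upto_knot; unfold Rminus, Rdiv.
    rewrite Rplus_opp_r, Rmult_0_l, clamp_id by lra.
    unfold quad; ring.
Qed.

Lemma hess_upto_bound n x : Rabs (hess_upto u s n x) <= 26 * u 0%nat.
Proof.
induction n as [|k IH]; simpl.
- pose proof (u_pos 0); rewrite Rabs_left1; lra.
- destruct Rle_dec; [exact IH|].
  pose proof (u_le_u0 k); pose proof (u_pos (S k)); pose proof (u_decr k).
  eapply Rle_trans; [apply quad_bound; [lra | apply clamp_bounds] | lra].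
Qed.

Lemma hess_upto_stable n m x :
  (n <= m)%nat -> x <= knot s n -> hess_upto u s m x = hess_upto u s n x.
Proof.
intros Hnm Hx; induction Hnm as [|m Hnm IH]; [reflexivity|].
simpl; pose proof (knot_le n m Hnm).
destruct Rle_dec; [exact IH | lra].
Qed.

Lemma spline_hess_upto n x :
  Rabs x <= knot s n -> spline_hess u s x = hess_upto u s n (Rabs x).
Proof.
intros Hx; unfold spline_hess.
rewrite (is_lim_seq_unique _ (Finite (hess_upto u s n (Rabs x)))); [reflexivity|].
apply is_lim_seq_ext_loc with (fun _ => hess_upto u s n (Rabs x)).
- exists n; intros m Hm; symmetry; now apply hess_upto_stable.
- apply is_lim_seq_const.
Qed.

Lemma spline_hess_even x : spline_hess u s (- x) = spline_hess u s x.
Proof. unfold spline_hess; now rewrite Rabs_Ropp. Qed.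

Lemma knot_nonneg k : 0 <= knot s k.
Proof. apply (knot_le 0); lia. Qed.

Lemma spline_hess_piece k x : knot s k <= x <= knot s (S k) ->
  spline_hess u s x = quad (u k) (u (S k)) ((x - knot s k) / s k).
Proof.
intros Hx; pose proof (knot_nonneg k).
assert (Habs : Rabs x = x) by (apply Rabs_pos_eq; lra).
rewrite (spline_hess_upto (S k)); rewrite Habs; [|lra].
now apply hess_upto_piece.
Qed.

Lemma spline_hess_knot k : spline_hess u s (knot s k) = -2 * u k.
Proof.
rewrite (spline_hess_upto k); rewrite (Rabs_pos_eq _ (knot_nonneg k)); [|lra].
apply hess_upto_knot.
Qed.

Lemma spline_hess_lipschitz : lipschitz (spline_hess u s).
Proof.
exists (24 * W); intros x y.
destruct (knot_unbounded (Rmax (Rabs x) (Rabs y))) as [n Hn].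
pose proof (Rmax_l (Rabs x) (Rabs y)); pose proof (Rmax_r (Rabs x) (Rabs y)).
rewrite (spline_hess_upto n x), (spline_hess_upto n y) by lra.
apply Rle_trans with (1 := hess_upto_lipschitz _ _ _).
pose proof W_pos; pose proof (Rabs_triang_inv2 x y).
apply Rmult_le_compat_l; lra.
Qed.

(** * Integration of the Hessian, and values at the knots *)

Lemma is_derive_spline_grad x :
  is_derive (spline_grad u s) x (spline_hess u s x).
Proof.
assert (Hc := continuous_of_lipschitz _ spline_hess_lipschitz).
apply (is_derive_RInt _ _ 0).
- apply filter_forall; intros y.
  apply (RInt_correct (V := R_CompleteNormedModule)).
  apply (ex_RInt_continuous (V := R_CompleteNormedModule)); auto.
- apply Hc.
Qed.

Lemma spline_grad_lipschitz : lipschitz (spline_grad u s).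
Proof.
apply lipschitz_of_bounded_derive with (spline_hess u s) (26 * u 0%nat).
- exact is_derive_spline_grad.
- intros x; destruct (knot_unbounded (Rabs x)) as [n Hn].
  rewrite (spline_hess_upto n x Hn); apply hess_upto_bound.
Qed.

Lemma is_derive_spline x : is_derive (spline u s) x (spline_grad u s x).
Proof.
assert (Hc := continuous_of_lipschitz _ spline_grad_lipschitz).
apply (is_derive_RInt _ _ 0).
- apply filter_forall; intros y.
  apply (RInt_correct (V := R_CompleteNormedModule)).
  apply (ex_RInt_continuous (V := R_CompleteNormedModule)); auto.
- apply Hc.
Qed.

Lemma spline_grad_0 : spline_grad u s 0 = 0.
Proof. apply (RInt_point (V := R_CompleteNormedModule)). Qed.

Lemma spline_0 : spline u s 0 = 0.
Proof. apply (RInt_point (V := R_CompleteNormedModule)). Qed.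

(** Both sides vanish at the left knot and have the same derivative; the factor [s k] cancels the
    one from the chain rule. *)
Lemma spline_grad_piece k x :
  spline_grad u s (knot s k) = 0 -> knot s k <= x <= knot s (S k) ->
  spline_grad u s x = s k * cubic (u k) (u (S k)) ((x - knot s k) / s k).
Proof.
intros H0 Hx; pose proof (s_pos k).
apply (eq_of_derive_eq (spline_grad u s)
  (fun y => s k * cubic (u k) (u (S k)) ((y - knot s k) / s k))
  (spline_hess u s)
  (fun y => quad (u k) (u (S k)) ((y - knot s k) / s k)) (knot s k)).
- lra.
- exact is_derive_spline_grad.
- intros y; unfold cubic, quad; auto_derive; [easy | field; lra].
- intros y Hy; apply spline_hess_piece; lra.
- rewrite H0; unfold cubic, Rminus, Rdiv; rewrite Rplus_opp_r; ring.
Qed.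

(** Zero gradients propagate from knot to knot because [cubic] vanishes at [1]. *)
Lemma spline_grad_knot k : spline_grad u s (knot s k) = 0.
Proof.
induction k as [|k IH]; [exact spline_grad_0|].
pose proof (s_pos k).
rewrite (spline_grad_piece k); [| exact IH | simpl; lra].
replace ((knot s (S k) - knot s k) / s k) with 1 by (simpl; field; lra).
unfold cubic; ring.
Qed.

(** * Boundedness below *)

(** The gradient is at least [-2 * u k * s k] here, over a length of at most [s k]. *)
Lemma spline_piece_lower_bound k x : knot s k <= x <= knot s (S k) ->
  spline u s (knot s k) - 2 * (u k * s k ^ 2) <= spline u s x.
Proof.
intros Hx; pose proof (s_pos k).
destruct (MVT_gen (spline u s) (knot s k) x (spline_grad u s)) as [c [Hc1 Hc2]].
- intros z _; apply is_derive_spline.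
- intros z _; apply continuity_pt_filterlim.
  apply (ex_derive_continuous (spline u s)); eexists; apply is_derive_spline.
- rewrite Rmin_left, Rmax_right in Hc1 by lra.
  rewrite (spline_grad_piece k c (spline_grad_knot k)) in Hc2 by lra.
  pose proof (u_pos k); pose proof (u_pos (S k)); pose proof (u_decr k).
  pose proof (cubic_lower_bound (u k) (u (S k)) ((c - knot s k) / s k)
    ltac:(lra) (ratio_bounds k c ltac:(lra))) as Hcub.
  set (p := cubic _ _ _) in *.
  simpl in Hx.
  assert (0 <= s k * (x - knot s k) <= s k ^ 2) by nra.
  nra.
Qed.

(** The even Hessian integrates to an odd gradient, which integrates to an even function. This
    reduces the lower bound to the nonnegative half-line. *)
Lemma spline_even x : spline u s (- x) = spline u s x.
Proof.
assert (odd_grad : forall y, 0 <= y -> - spline_grad u s (- y) = spline_grad u s y).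
{ intros y Hy.
  apply (eq_of_derive_eq (fun z => - spline_grad u s (- z)) (spline_grad u s)
    (spline_hess u s) (spline_hess u s) 0); auto using is_derive_spline_grad.
  - intros z; evar_last.
    + apply (is_derive_opp (fun t => spline_grad u s (- t))).
      apply (is_derive_comp (spline_grad u s)); [apply is_derive_spline_grad|].
      apply (is_derive_opp (fun t : R => t)), is_derive_id.
    + rewrite spline_hess_even; unfold scal, opp, one; simpl.
      unfold mult; simpl; ring.
  - rewrite Ropp_0, spline_grad_0; ring. }
assert (even : forall y, 0 <= y -> spline u s (- y) = spline u s y).
{ intros y Hy.
  apply (eq_of_derive_eq (fun z => spline u s (- z)) (spline u s)
    (fun z => - spline_grad u s (- z)) (spline_grad u s) 0);
    auto using is_derive_spline.
  - intros z; evar_last.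
    + apply (is_derive_comp (spline u s)); [apply is_derive_spline|].
      apply (is_derive_opp (fun t : R => t)), is_derive_id.
    + unfold scal, opp, one; simpl; unfold mult; simpl; ring.
  - intros z Hz; apply odd_grad; lra.
  - now rewrite Ropp_0. }
destruct (Rle_dec 0 x); [now apply even|].
rewrite <- (even (- x)) by lra; now rewrite Ropp_involutive.
Qed.

Lemma spline_lower_bound_upto n x : 0 <= x <= knot s n ->
  - 2 * M <= spline u s x.
Proof.
(* The descents of successive intervals accumulate: the bound at the right end of one interval
   starts the next. *)
assert (Hle : forall k y, knot s k <= y <= knot s (S k) ->
  -2 * sum_f_R0 (fun l => u l * s l ^ 2) k <= spline u s y).
{ induction k as [|k IH]; intros y Hy;
    pose proof (spline_piece_lower_bound _ _ Hy) as H.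
  - simpl in H |- *; rewrite spline_0 in H; lra.
  - pose proof (s_pos k).
    pose proof (IH (knot s (S k)) ltac:(simpl; lra)).
    cbn [sum_f_R0]; lra. }
assert (HM : forall k y, knot s k <= y <= knot s (S k) -> -2 * M <= spline u s y).
{ intros k y Hy; pose proof (Hle k y Hy); pose proof (sum_bound k); lra. }
induction n as [|n IH]; intros Hx.
- apply (HM 0%nat); simpl in *; pose proof (s_pos 0); lra.
- destruct (Rle_dec x (knot s n)); [apply IH; lra|].
  apply (HM n); lra.
Qed.

Lemma spline_bounded_below : bounded_below (spline u s).
Proof.
exists (-2 * M); intros x.
destruct (knot_unbounded (Rabs x)) as [n Hn].
replace (spline u s x) with (spline u s (Rabs x)).
- apply (spline_lower_bound_upto n); split; [apply Rabs_pos | exact Hn].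
- unfold Rabs; destruct Rcase_abs; [apply spline_even | reflexivity].
Qed.

(** * Transfer to the derivatives of the objective function *)

Lemma grad_spline x : grad (spline u s) x = spline_grad u s x.
Proof. apply is_derive_unique, is_derive_spline. Qed.

Lemma hess_spline x : hess (spline u s) x = spline_hess u s x.
Proof.
unfold hess; simpl.
rewrite (Derive_ext _ (spline_grad u s)); [|exact grad_spline].
apply is_derive_unique, is_derive_spline_grad.
Qed.

Lemma spline_C2 : C2 (spline u s).
Proof.
split; [|split]; intros x.
- exists (spline_grad u s x); apply is_derive_spline.
- exists (spline_hess u s x); simpl.
  apply (is_derive_ext (spline_grad u s)).
  + intros t; symmetry; apply grad_spline.
  + apply is_derive_spline_grad.
- apply (continuous_ext (spline_hess u s)).
  + intros t; symmetry; apply hess_spline.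
  + apply continuous_of_lipschitz, spline_hess_lipschitz.
Qed.

Lemma grad_spline_lipschitz : lipschitz (grad (spline u s)).
Proof. apply (lipschitz_ext _ _ grad_spline spline_grad_lipschitz). Qed.

Lemma hess_spline_lipschitz : lipschitz (hess (spline u s)).
Proof. apply (lipschitz_ext _ _ hess_spline spline_hess_lipschitz). Qed.

Lemma grad_spline_knot k : grad (spline u s) (knot s k) = 0.
Proof. rewrite grad_spline; apply spline_grad_knot. Qed.

Lemma hess_spline_knot k : hess (spline u s) (knot s k) = -2 * u k.
Proof. rewrite hess_spline; apply spline_hess_knot. Qed.

End Spline.

(** * Series estimates *)

Lemma ln_succ_ratio (m : R) : 0 < m -> / (m + 1) <= ln (m + 1) - ln m.
Proof.
intros Hm.
pose proof (exp_ineq1_le (ln m - ln (m + 1))) as H.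
unfold Rminus in H; rewrite exp_plus, exp_Ropp, !exp_ln in H by lra.
apply (Rplus_le_reg_r (-1)).
replace (/ (m + 1) + -1) with (- (m * / (m + 1))) by (field; lra).
lra.
Qed.

Lemma ln_succ_ratio_le (m : R) : 0 < m -> ln (m + 1) - ln m <= / m.
Proof.
intros Hm.
pose proof (exp_ineq1_le (ln (m + 1) - ln m)) as H.
unfold Rminus in H; rewrite exp_plus, exp_Ropp, !exp_ln in H by lra.
replace (/ m) with ((m + 1) * / m - 1) by (field; lra).
lra.
Qed.

(* [exp t >= 1 + t] at [t = d * ln ((m+1)/m)] gives the telescoping bound. *)
Lemma Rpower_telescope (d m : R) : 0 < d -> 0 < m ->
  d * Rpower (m + 1) (- (1 + d)) <= Rpower m (- d) - Rpower (m + 1) (- d).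
Proof.
intros Hd Hm.
assert (E1 : Rpower (m + 1) (- (1 + d)) = / (m + 1) * Rpower (m + 1) (- d)).
{ replace (- (1 + d)) with (Ropp 1 + - d) by ring.
  rewrite Rpower_plus, Rpower_Ropp, Rpower_1 by lra; reflexivity. }
assert (E2 : Rpower m (- d)
             = Rpower (m + 1) (- d) * exp (d * (ln (m + 1) - ln m))).
{ unfold Rpower; rewrite <- exp_plus; f_equal; ring. }
rewrite E1, E2.
assert (0 < Rpower (m + 1) (- d)) by apply exp_pos.
pose proof (exp_ineq1_le (d * (ln (m + 1) - ln m))).
pose proof (ln_succ_ratio m Hm).
set (P := Rpower (m + 1) (- d)) in *.
assert (d * / (m + 1) <= exp (d * (ln (m + 1) - ln m)) - 1) by nra.
nra.
Qed.

Lemma p_series_bound (d : R) (n : nat) : 0 < d ->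
  sum_f_R0 (fun l => Rpower (INR (l + 1)) (- (1 + d))) n <= 1 + / d.
Proof.
intros Hd.
(* Keeping the telescoping remainder makes the induction go through; it is dropped at the end. *)
assert (H : sum_f_R0 (fun l => Rpower (INR (l + 1)) (- (1 + d))) n
            <= 1 + / d * (1 - Rpower (INR (n + 1)) (- d))).
{ induction n as [|n IH].
  - simpl; unfold Rpower; rewrite ln_1, !Rmult_0_r, exp_0; lra.
  - cbn [sum_f_R0].
    replace (INR (S n + 1)) with (INR (n + 1) + 1)
      by now rewrite Nat.add_succ_l, S_INR.
    assert (Hn : 0 < INR (n + 1)) by (apply lt_0_INR; lia).
    pose proof (Rpower_telescope d _ Hd Hn) as T.
    apply (Rmult_le_compat_l (/ d)) in T;
      [|left; now apply Rinv_0_lt_compat].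
    rewrite <- Rmult_assoc, Rinv_l, Rmult_1_l in T by lra.
    lra. }
assert (0 < Rpower (INR (n + 1)) (- d)) by apply exp_pos.
assert (0 < / d) by now apply Rinv_0_lt_compat.
nra.
Qed.

(** Each step dominates [c] times an increment of the logarithm, so [knot s n] is at least
    [c * ln (INR (n + 1))]. *)
Lemma knot_unbounded_of_harmonic (s : nat -> R) (c : R) :
  0 < c -> (forall k, c / INR (k + 1) <= s k) ->
  forall x, exists n, x <= knot s n.
Proof.
intros Hc Hs x.
assert (Hk : forall n, c * ln (INR (n + 1)) <= knot s n).
{ induction n as [|n IH].
  - simpl; rewrite ln_1; lra.
  - assert (Hn : 0 < INR (n + 1)) by (apply lt_0_INR; lia).
    replace (INR (S n + 1)) with (INR (n + 1) + 1)
      by now rewrite Nat.add_succ_l, S_INR.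
    pose proof (ln_succ_ratio_le _ Hn).
    pose proof (Hs n); simpl; unfold Rdiv in *; nra. }
destruct (INR_archimed 1 (exp (x / c)) ltac:(lra)) as [n Hn].
exists n; apply Rle_trans with (2 := Hk n).
assert (x / c <= ln (INR (n + 1))).
{ rewrite <- (ln_exp (x / c)); apply ln_le; [apply exp_pos|].
  rewrite plus_INR; simpl; lra. }
replace x with (c * (x / c)) by (field; lra).
apply Rmult_le_compat_l; lra.
Qed.

(** * ASTR2 at a stationary point of negative curvature *)

Lemma model_dec_stationary (a d : R) : model_dec 0 (-2 * a) d = a * d ^ 2.
Proof. unfold model_dec; field. Qed.

Lemma is_phi_stationary (a : R) : 0 <= a -> is_phi 0 (-2 * a) a.
Proof.
intros Ha; split.
- exists 1; rewrite Rabs_R1, model_dec_stationary; lra.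
- intros y [d [Hd ->]]; rewrite model_dec_stationary.
  apply Rabs_le_between in Hd; assert (d ^ 2 <= 1) by nra; nra.
Qed.

(** With zero gradient the Cauchy decrease is zero. Along the eigenvector [1] the best decrease is
    that of the full step itself, so [tau <= 1] suffices. *)
Lemma quadratic_step_stationary (tau chi a D : R) :
  0 < tau <= 1 -> 0 < chi <= 1 -> 0 <= a -> 0 <= D ->
  quadratic_step tau chi 0 (-2 * a) D D.
Proof.
intros Ht Hc Ha HD; split; [rewrite Rabs_pos_eq; lra|].
exists 1, 0, (a * D ^ 2).
split; [nra|]; split; [lra|]; split; [apply Rabs_R1|].
assert (0 <= a * D ^ 2) by nra.
split; [|split].
- split.
  + exists 0; rewrite model_dec_stationary, Rabs_R0; lra.
  + intros y [al [_ [_ ->]]]; rewrite model_dec_stationary; nra.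
- split.
  + exists D; rewrite model_dec_stationary, Rmult_1_r; lra.
  + intros y [al [Hal ->]]; rewrite model_dec_stationary, Rmult_1_r.
    assert (al ^ 2 <= D ^ 2) by nra; nra.
- rewrite model_dec_stationary, Rmax_right by lra; nra.
Qed.

(** * Choice of the sequences and verification of the run *)

Theorem theorem3p4 :
  forall mu nu thetaL thetaQ eps sigma : R,
    0 < mu < 1 -> 0 < nu < 1 -> thetaL = 1 -> thetaQ = 1 ->
    0 < eps < 2 / 3 -> 0 < sigma ->
  exists f : R -> R,
    C2 f /\ lipschitz (grad f) /\ lipschitz (hess f) /\ bounded_below f /\
    forall tau chi xi : R,
      0 < tau <= 1 -> 0 < chi <= 1 -> 1 <= xi ->
      exists x s phi phih wL wQ : nat -> R,
        ASTR2_run tau chi xi f 0 x s phi phih wL wQ /\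
        scaling_rule thetaL thetaQ sigma mu nu
          (fun k => grad f (x k)) phih wL wQ /\
        forall k : nat,
          phi k = phih k /\
          is_min (fun y => exists j : nat, (j <= k)%nat /\ y = phih j) (phih k) /\
          phih k = 1 / Rpower (INR (k + 1)) (1 / 3 + eps).
Proof.
intros mu nu thetaL thetaQ eps sigma Hmu Hnu -> -> Heps Hsigma.
set (u := fun k : nat => 1 / Rpower (INR (k + 1)) (1 / 3 + eps)).
set (total := fun k : nat => sigma + sum_f_R0 (fun l => u l ^ 3) k).
(* This anticipates [hat_wQ] for a run with only quadratic steps. It does not refer to [f], so the
   steps, and from them [f], can be defined without circularity. *)
set (w := fun k : nat => Rpower (total k) nu).
set (s := fun k : nat => u k / w k).
set (Mtot := sigma + (1 + / (3 * eps))).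
assert (arg_ge1 : forall k, 1 <= INR (k + 1))
  by (intros k; rewrite plus_INR; simpl; pose proof (pos_INR k); lra).
assert (u_pos : forall k, 0 < u k)
  by (intros k; apply Rdiv_lt_0_compat; [lra | apply exp_pos]).
assert (u_mono : forall j k, (j <= k)%nat -> u k <= u j).
{ intros j k Hjk; unfold u, Rdiv; rewrite !Rmult_1_l.
  apply Rinv_le_contravar; [apply exp_pos|].
  apply Rle_Rpower_l; [lra|].
  pose proof (arg_ge1 j); split; [lra | apply le_INR; lia]. }
assert (u_le1 : forall k, u k <= 1).
{ intros k; apply Rle_trans with (1 := u_mono 0%nat k ltac:(lia)).
  unfold u; simpl; unfold Rpower; rewrite ln_1, Rmult_0_r, exp_0; lra. }
assert (cube_sum : forall k, 0 <= sum_f_R0 (fun l => u l ^ 3) k <= 1 + / (3 * eps)).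
{ intros k; split.
  - apply cond_pos_sum; intros l; apply pow_le; left; apply u_pos.
  (* Cubing turns the exponent [1 / 3 + eps] into [1 + 3 * eps], which exceeds [1]. *)
  - rewrite (sum_eq _ (fun l => Rpower (INR (l + 1)) (- (1 + 3 * eps)))).
    + apply p_series_bound; lra.
    + intros l _; unfold u, Rdiv.
      rewrite Rmult_1_l, <- Rpower_Ropp, <- Rpower_pow, Rpower_mult
        by apply exp_pos.
      f_equal; simpl; field. }
assert (w_pos : forall k, 0 < w k) by (intros k; apply exp_pos).
set (w0 := Rpower sigma nu); set (W := Rpower Mtot nu).
assert (w0_pos : 0 < w0) by apply exp_pos.
assert (Wmax_pos : 0 < W) by apply exp_pos.
assert (w_bounds : forall k, w0 <= w k <= W).
{ intros k; pose proof (cube_sum k); unfold w0, W, w, total, Mtot.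
  split; apply Rle_Rpower_l; lra. }
assert (s_pos : forall k, 0 < s k)
  by (intros k; apply Rdiv_lt_0_compat; auto).
assert (us : forall k, u k = w k * s k)
  by (intros k; unfold s; field; apply Rgt_not_eq, w_pos).
assert (u_le_s : forall k, u k <= W * s k).
{ intros k; rewrite us at 1; pose proof (w_bounds k); pose proof (s_pos k).
  nra. }
assert (u_decr : forall k, u (S k) <= u k) by (intros k; apply u_mono; lia).
assert (unbounded : forall x, exists n, x <= knot s n).
{ apply (knot_unbounded_of_harmonic s (/ W)); [now apply Rinv_0_lt_compat|].
  intros k.
  (* Here [eps < 2 / 3] enters: the exponent [1 / 3 + eps] is below [1]. *)
  assert (Hu : / INR (k + 1) <= u k).
  { pose proof (arg_ge1 k).
    unfold u, Rdiv; rewrite Rmult_1_l.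
    apply Rinv_le_contravar; [apply exp_pos|].
    rewrite <- (Rpower_1 (INR (k + 1))) at 2 by lra.
    apply Rle_Rpower; lra. }
  pose proof (u_le_s k).
  apply (Rmult_le_reg_l W); [lra|].
  replace (W * (/ W / INR (k + 1))) with (/ INR (k + 1)); [lra|].
  pose proof (arg_ge1 k); field; lra. }
assert (decrease_sum : forall n,
  sum_f_R0 (fun l => u l * s l ^ 2) n <= (1 + / (3 * eps)) * / w0 ^ 2).
{ intros n.
  apply Rle_trans with (sum_f_R0 (fun l => u l ^ 3 * / w0 ^ 2) n).
  - apply sum_Rle; intros l _.
    assert (s l <= u l * / w0).
    { unfold s, Rdiv; apply Rmult_le_compat_l; [left; apply u_pos|].
      apply Rinv_le_contravar; [lra | apply w_bounds]. }
    replace (u l ^ 3 * / w0 ^ 2) with (u l * (u l * / w0) ^ 2) by (field; lra).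
    pose proof (u_pos l); pose proof (s_pos l).
    apply Rmult_le_compat_l; [lra|].
    apply pow_incr; lra.
  - rewrite <- scal_sum, Rmult_comm; apply Rmult_le_compat_r; [|apply cube_sum].
    left; apply Rinv_0_lt_compat, pow_lt, w0_pos. }
exists (spline u s).
split; [now apply (spline_C2 u s W)|].
split; [now apply (grad_spline_lipschitz u s W)|].
split; [now apply (hess_spline_lipschitz u s W)|].
split; [now apply (spline_bounded_below u s W ((1 + / (3 * eps)) * / w0 ^ 2))|].
intros tau chi xi Htau Hchi Hxi.
set (g := fun k => grad (spline u s) (knot s k)).
assert (g0 : forall k, g k = 0)
  by (intros k; now apply (grad_spline_knot u s W)).
assert (h0 : forall k, hess (spline u s) (knot s k) = -2 * u k)
  by (intros k; now apply (hess_spline_knot u s W)).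
(* The squared gradient is zero while the cubed measure is positive. *)
assert (notKL : forall k, ~ in_KL g u k).
{ intros k H; unfold in_KL in H; rewrite g0, Rabs_R0 in H.
  pose proof (pow_lt _ 3 (u_pos k)); simpl in *; lra. }
assert (hat_w : forall k, hat_wQ sigma nu g u k = w k).
{ intros k; unfold hat_wQ, w, total; do 2 f_equal; apply sum_eq.
  intros l _; destruct in_KL_dec as [H|]; [now apply notKL in H | reflexivity]. }
exists (knot s), s, u, u, (hat_wL sigma mu g u), w.
split; [split|split].
- reflexivity.
- intros k; rewrite h0; change (grad _ _) with (g k); rewrite g0.
  apply is_phi_stationary; left; apply u_pos.
(* The cap [xi] is inactive since [u k <= 1 <= xi], so one [f] serves all parameters. *)
- intros k; rewrite Rmin_left; [reflexivity | pose proof (u_le1 k); lra].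
- intros k H; now apply notKL in H.
- intros k _; rewrite h0; change (grad _ _) with (g k); rewrite g0.
  apply quadratic_step_stationary; auto; left; [apply u_pos | apply s_pos].
- reflexivity.
- intros k; fold g; rewrite hat_w; lra.
- intros k; split; [reflexivity|]; split; [split|].
  + now exists k.
  + intros y [j [Hj ->]]; now apply u_mono.
  + reflexivity.
Qed.
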